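(* Let $L$ be a nilpotent, finite-dimensional diassociative algebra over a field $\mathbb{F}$. Then $$\dim\mathcal{H}^2(L,\mathbb{F})\le\dim\mathcal{H}^2(L/L',\mathbb{F})+\dim(L')\bigl[4\dim(L/L')-1\bigr].$$
   Context: A diassociative algebra $L$ over a field $\mathbb{F}$ is an $\mathbb{F}$-vector space with two associative bilinear products $\dashv,\vdash$ satisfying $x\dashv(y\dashv z)=x\dashv(y\vdash z)$, $(x\vdash y)\dashv z=x\vdash(y\dashv z)$, $(x\dashv y)\vdash z=(x\vdash y)\vdash z$ for all $x,y,z\in L$. For subalgebras $X,Y$ of $L$, $X\lozenge Y=X\dashv Y+X\vdash Y$, where $X\dashv Y$ and $X\vdash Y$ are the spans of the corresponding products. $L'=L\lozenge L$. The lower central series is $L^1=L$, $L^{k+1}=L^1\lozenge L^k+L^2\lozenge L^{k-1}+\cdots+L^k\lozenge L^1$; $L$ is nilpotent if $L^k=0$ for some $k$. For a diassociative algebra $Q$ over $\mathbb{F}$, $\mathcal{Z}^2(Q,\mathbb{F})$ is the space of pairs $(f_{\dashv},f_{\vdash})$ of bilinear forms $Q\times Q\to\mathbb{F}$ such that for all $i,j,k\in Q$: $f_{\dashv}(i,j\dashv k)=f_{\dashv}(i,j\vdash k)$; $f_{\dashv}(i\vdash j,k)=f_{\vdash}(i,j\dashv k)$; $f_{\vdash}(i\dashv j,k)=f_{\vdash}(i\vdash j,k)$; $f_{\dashv}(i,j\dashv k)=f_{\dashv}(i\dashv j,k)$; $f_{\vdash}(i,j\vdash k)=f_{\vdash}(i\vdash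 j,k)$. $\mathcal{B}^2(Q,\mathbb{F})$ is the subspace of pairs for which there is a linear map $\varepsilon:Q\to\mathbb{F}$ with $f_{\dashv}(x,y)=-\varepsilon(x\dashv y)$ and $f_{\vdash}(x,y)=-\varepsilon(x\vdash y)$ for all $x,y$; and $\mathcal{H}^2(Q,\mathbb{F})=\mathcal{Z}^2(Q,\mathbb{F})/\mathcal{B}^2(Q,\mathbb{F})$. *)

(* Defs.v *)
From HB Require Import structures.
From mathcomp Require Import all_boot all_order all_algebra.
From mathcomp Require Import boolp.

Set Implicit Arguments.
Unset Strict Implicit.
Unset Printing Implicit Defensive.

Import GRing.Theory.
Local Open Scope ring_scope.

Section VSpan.
Variables (F : fieldType) (vT : vectType F).
Implicit Types (P : vT -> Prop) (U W : {vspace vT}).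

Lemma vspan_exists P : exists U : {vspace vT},
  (forall v, P v -> v \in U) /\
  (forall W : {vspace vT}, (forall v, P v -> v \in W) -> (U <= W)%VS).
Proof.
pose ok n := `[< exists U : {vspace vT}, \dim U = n /\ forall v, P v -> v \in U >].
have exok : exists n, ok n.
  by exists (\dim {:vT}); apply/asboolP; exists fullv; split=> // v; rewrite memvf.
case: (ex_minnP exok) => n /asboolP[U [dimU PU]] minU.
exists U; split=> // W PW; have capP v : P v -> v \in (U :&: W)%VS.
  by move=> Pv; rewrite memv_cap PU ?PW.
have le_n : (\dim U <= \dim (U :&: W))%N.
  by rewrite dimU; apply: minU; apply/asboolP; exists (U :&: W)%VS.
apply: subv_trans (capvSr U W).
by rewrite -(geq_leqif (dimv_leqif_sup (capvSl U W))).
Qed.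

(* The linear span of an arbitrary (possibly infinite) family of vectors. *)
Definition vspan P : {vspace vT} := projT1 (cid (vspan_exists P)).

Lemma mem_vspan P v : P v -> v \in vspan P.
Proof. by rewrite /vspan; case: cid => U [/= + _]; apply. Qed.

Lemma vspan_sub P W : (forall v, P v -> v \in W) -> (vspan P <= W)%VS.
Proof. by rewrite /vspan; case: cid => U [/= _]; apply. Qed.

Lemma vspanP P v : P 0 -> (forall a x y, P x -> P y -> P (a *: x + y)) ->
  v \in vspan P <-> P v.
Proof.
move=> P0 Plin; split; last exact: mem_vspan.
pose ok n := `[< exists U : {vspace vT}, \dim U = n /\ forall v, v \in U -> P v >].
have exok : exists n, ok n.
  exists 0%N; apply/asboolP; exists 0%VS; split; first exact: dimv0.
  by move=> x; rewrite memv0 => /eqP->.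
have ubok n : ok n -> (n <= \dim {:vT})%N.
  by move=> /asboolP[U [<- _]]; rewrite dimvS ?subvf.
case: (ex_maxnP exok ubok) => n /asboolP[U [dimU UP]] maxU vP.
apply: (UP); apply: subvP v vP; apply: vspan_sub => v Pv.
have UvP : forall w, w \in (U + <[v]>)%VS -> P w.
  move=> w /memv_addP[u Uu [_ /vlineP[a ->] ->]].
  by rewrite addrC; apply: Plin => //; apply: UP.
have le_n : (\dim (U + <[v]>) <= \dim U)%N.
  by rewrite dimU; apply: maxU; apply/asboolP; exists (U + <[v]>)%VS.
rewrite (geq_leqif (dimv_leqif_sup (addvSl U <[v]>))) in le_n.
by apply: subvP le_n _ _; apply: subvP (addvSr U <[v]>) _ (memv_line v).
Qed.

End VSpan.

(* The quotient vector space [vT / U]. *)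
Definition quotv (F : fieldType) (vT : vectType F) (U : {vspace vT}) :=
  Quotient.quot U.

Section QuotV.
Variables (F : fieldType) (vT : vectType F) (U : {vspace vT}).
Local Notation Q := (quotv U).

HB.instance Definition _ := GRing.Zmodule.on Q.

Definition piv (x : vT) : Q := \pi_(Quotient.quot U)%qT x.
Definition reprv (q : Q) : vT := repr (q : Quotient.quot U).

Lemma reprvK : cancel reprv piv. Proof. exact: reprK. Qed.

Lemma piv_eq x y : (piv x == piv y) = (x - y \in U).
Proof. by rewrite Quotient.idealrBE. Qed.

Lemma pivB : {morph piv : x y / x - y}.
Proof. by move=> x y; rewrite /piv raddfB. Qed.

Lemma pivD : {morph piv : x y / x + y}.
Proof. by move=> x y; rewrite /piv raddfD. Qed.

Lemma reprv_pi x : reprv (piv x) - x \in U.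
Proof. by rewrite -piv_eq reprvK. Qed.

Definition scaleq (a : F) (q : Q) : Q := piv (a *: reprv q).

Lemma pivZ a x : piv (a *: x) = scaleq a (piv x).
Proof.
by apply/eqP; rewrite piv_eq -scalerBr -rpredN -scalerN opprB rpredZ ?reprv_pi.
Qed.

Fact scaleqA a b q : scaleq a (scaleq b q) = scaleq (a * b) q.
Proof. by rewrite -[q]reprvK -!pivZ scalerA. Qed.
Fact scale1q : left_id 1 scaleq.
Proof. by move=> q; rewrite -[q]reprvK -!pivZ scale1r. Qed.
Fact scaleqDr : right_distributive scaleq +%R.
Proof.
by move=> a x y; rewrite -[x]reprvK -[y]reprvK -pivD -!pivZ -pivD scalerDr.
Qed.
Fact scaleqDl q : {morph scaleq^~ q : a b / a + b}.
Proof. by move=> a b; rewrite -[q]reprvK -!pivZ -pivD scalerDl. Qed.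

HB.instance Definition _ :=
  GRing.Zmodule_isLmodule.Build F Q scaleqA scale1q scaleqDr scaleqDl.

Fact piv_is_linear : linear piv.
Proof. by move=> a x y; rewrite pivD pivZ. Qed.
HB.instance Definition _ := GRing.isLinear.Build F vT Q _ piv piv_is_linear.

Fact quotv_vect_iso : Vector.axiom (\dim U^C) Q.
Proof.
pose p := daddv_pi U^C U.
have cap0 : (U^C :&: U = 0)%VS by rewrite capvC capv_compl.
have full : (U^C + U)%VS = fullv by rewrite addvC addv_complf.
have pE x : x - p x \in U.
  have xE : p x + daddv_pi U U^C x = x by rewrite daddv_pi_add ?full ?memvf.
  by rewrite -[X in X - _]xE addrC addKr memv_pi.
have p0 u : u \in U -> p u = 0.
  move=> Uu; apply/eqP; rewrite -memv0 -cap0 memv_cap memv_pi /=.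
  by rewrite -[p u](subKr u) rpredB.
have pP x y : x - y \in U -> p x = p y.
  by move=> /p0; rewrite linearB /= => /subr0_eq.
exists (fun q => \row_i coord (vbasis U^C) i (p (reprv q))).
  move=> a q r; apply/rowP => i; rewrite !mxE.
  have E : reprv (a *: q + r) - (a *: reprv q + reprv r) \in U.
    by rewrite -piv_eq reprvK linearP /= !reprvK.
  by rewrite (pP _ _ E) !linearP.
exists (fun r : 'rV_(\dim U^C) => piv (\sum_i r 0 i *: (vbasis U^C)`_i)).
  move=> q /=; rewrite -[RHS]reprvK; apply/eqP; rewrite piv_eq -rpredN opprB.
  rewrite [X in _ - X](_ : _ = p (reprv q)) ?pE //.
  rewrite [RHS](coord_vbasis (memv_pi _ _ _)).
  by apply: eq_bigr => i _; rewrite mxE.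
move=> r; apply/rowP => i; rewrite mxE (pP _ _ (reprv_pi _)) [p _]daddv_pi_id //.
  by rewrite coord_sum_free ?(basis_free (vbasisP _)).
by apply: rpred_sum => j _; rewrite rpredZ ?vbasis_mem ?memt_nth.
Qed.

HB.instance Definition _ := Lmodule_hasFinDim.Build F Q quotv_vect_iso.

Lemma dim_quotv : \dim {:Q} = (\dim {:vT} - \dim U)%N.
Proof. by rewrite dimvf -dimv_compl. Qed.

End QuotV.

HB.mixin Record isDiassociative (F : fieldType) L of Vector F L := {
  dil : L -> L -> L;
  dir : L -> L -> L;
  dil_bilinear : bilinear_for *:%R *:%R dil;
  dir_bilinear : bilinear_for *:%R *:%R dir;
  dilA : associative dil;
  dirA : associative dir;
  dil_lr : forall x y z, dil x (dil y z) = dil x (dir y z);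
  dirl_dil : forall x y z, dil (dir x y) z = dir x (dil y z);
  dir_lr : forall x y z, dir (dil x y) z = dir (dir x y) z
}.

(* Finite-dimensional diassociative algebras over [F]. *)
#[short(type="diassocType")]
HB.structure Definition Diassociative (F : fieldType) :=
  {L of isDiassociative F L & Vector F L}.

Notation "x ⊣ y" := (dil x y) (at level 40, left associativity) : ring_scope.
Notation "x ⊢ y" := (dir x y) (at level 40, left associativity) : ring_scope.

HB.instance Definition _ (F : fieldType) (L : diassocType F) :=
  bilinear_isBilinear.Build F L L L *:%R *:%R (@dil F L) (@dil_bilinear F L).
HB.instance Definition _ (F : fieldType) (L : diassocType F) :=
  bilinear_isBilinear.Build F L L L *:%R *:%R (@dir F L) (@dir_bilinear F L).

Section LowerCentralSeries.
Variables (F : fieldType) (L : diassocType F).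
Implicit Types X Y : {vspace L}.

Definition dilv X Y : {vspace L} :=
  vspan (fun z => exists x y, [/\ x \in X, y \in Y & z = x ⊣ y]).
Definition dirv X Y : {vspace L} :=
  vspan (fun z => exists x y, [/\ x \in X, y \in Y & z = x ⊢ y]).

Definition lozenge X Y : {vspace L} := (dilv X Y + dirv X Y)%VS.

Definition derived : {vspace L} := lozenge fullv fullv.

(* [lcs_seq k] is the list [:: L^1; ...; L^k]. *)
Fixpoint lcs_seq (k : nat) : seq {vspace L} :=
  if k is k'.+1 then
    let s := lcs_seq k' in
    rcons s (if k' is 0 then fullv
             else (\sum_(i < k') lozenge (nth 0 s i) (nth 0 s (k' - i.+1)))%VS)
  else [::].

(* [lcs k] is [L^k]; the series starts at [k = 1], the value at [0] is junk. *)
Definition lcs (k : nat) : {vspace L} := last fullv (lcs_seq k).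

Definition nilpotent : Prop := exists k, lcs k.+1 = 0%VS.

Lemma size_lcs_seq k : size (lcs_seq k) = k.
Proof. by elim: k => //= k IHk; rewrite size_rcons IHk. Qed.

Lemma nth_lcs_seq k i : (i < k)%N -> nth 0%VS (lcs_seq k) i = lcs i.+1.
Proof.
elim: k => // k IHk lt_i; rewrite /= nth_rcons size_lcs_seq.
move: lt_i; rewrite ltnS leq_eqVlt => /predU1P[->|lt_ik].
  by rewrite ltnn eqxx /lcs /= last_rcons.
by rewrite lt_ik IHk.
Qed.

Lemma lcs1 : lcs 1 = fullv. Proof. by []. Qed.

Lemma lcsS k : (0 < k)%N ->
  lcs k.+1 = (\sum_(1 <= i < k.+1) lozenge (lcs i) (lcs (k.+1 - i)))%VS.
Proof.
case: k => // k _; rewrite {1}/lcs.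
have -> : lcs_seq k.+2 = rcons (lcs_seq k.+1) (\sum_(i < k.+1)
    lozenge (nth 0 (lcs_seq k.+1) i) (nth 0 (lcs_seq k.+1) (k.+1 - i.+1)))%VS.
  by [].
rewrite last_rcons.
rewrite big_add1 big_mkord; apply: eq_bigr => i _.
have lt_i : (k.+1 - i.+1 < k.+1)%N by rewrite subSS ltnS leq_subr.
by rewrite !nth_lcs_seq // -subSn.
Qed.

Lemma lcs2 : lcs 2 = derived.
Proof. by rewrite lcsS // big_nat1. Qed.

End LowerCentralSeries.

Section Abelianization.
Variables (F : fieldType) (L : diassocType F).
Local Notation L' := (derived L).

Lemma dil_derived (x y : L) : x ⊣ y \in L'.
Proof.
apply: subvP (addvSl _ _) _ _; apply: mem_vspan.
by exists x, y; rewrite !memvf.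
Qed.

Lemma dir_derived (x y : L) : x ⊢ y \in L'.
Proof.
apply: subvP (addvSr _ _) _ _; apply: mem_vspan.
by exists x, y; rewrite !memvf.
Qed.

Definition dquot := quotv L'.
HB.instance Definition _ := Vector.on dquot.

Definition dilq (p q : dquot) : dquot := piv L' (reprv p ⊣ reprv q).
Definition dirq (p q : dquot) : dquot := piv L' (reprv p ⊢ reprv q).

(* The products of the quotient are well defined because [L'] is an ideal. *)
Lemma dilqE (x y : L) : dilq (piv L' x) (piv L' y) = piv L' (x ⊣ y).
Proof. by apply/eqP; rewrite piv_eq rpredB ?dil_derived. Qed.

Lemma dirqE (x y : L) : dirq (piv L' x) (piv L' y) = piv L' (x ⊢ y).
Proof. by apply/eqP; rewrite piv_eq rpredB ?dir_derived. Qed.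

Let repE (q : dquot) : q = piv L' (reprv q).
Proof. by rewrite reprvK. Qed.

Fact dilq_bilinear : bilinear_for *:%R *:%R dilq.
Proof.
split=> r a p q; rewrite (repE p) (repE q) (repE r) -linearP !dilqE -linearP.
  by rewrite linearPl.
by rewrite linearPr.
Qed.
Fact dirq_bilinear : bilinear_for *:%R *:%R dirq.
Proof.
split=> r a p q; rewrite (repE p) (repE q) (repE r) -linearP !dirqE -linearP.
  by rewrite linearPl.
by rewrite linearPr.
Qed.
Fact dilqA : associative dilq.
Proof. by move=> p q r; rewrite (repE p) (repE q) (repE r) !dilqE dilA. Qed.
Fact dirqA : associative dirq.
Proof. by move=> p q r; rewrite (repE p) (repE q) (repE r) !dirqE dirA. Qed.
Fact dilq_lr p q r : dilq p (dilq q r) = dilq p (dirq q r).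
Proof. by rewrite (repE p) (repE q) (repE r) !(dilqE, dirqE) dil_lr. Qed.
Fact dirlq_dil p q r : dilq (dirq p q) r = dirq p (dilq q r).
Proof. by rewrite (repE p) (repE q) (repE r) !(dilqE, dirqE) dirl_dil. Qed.
Fact dirq_lr p q r : dirq (dilq p q) r = dirq (dirq p q) r.
Proof. by rewrite (repE p) (repE q) (repE r) !(dilqE, dirqE) dir_lr. Qed.

HB.instance Definition _ := isDiassociative.Build F dquot
  dilq_bilinear dirq_bilinear dilqA dirqA dilq_lr dirlq_dil dirq_lr.

End Abelianization.

Section Cohomology.
Variables (F : fieldType) (Q : diassocType F).

(* A bilinear form [Q x Q -> F] is given in curried form, as an element of the
   vector space 'Hom(Q, 'Hom(Q, F^o)); a cochain is a pair [(f_⊣, f_⊢)]. *)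
Local Notation bilform := 'Hom(Q, 'Hom(Q, F^o)).
Local Notation cochain2 := (bilform * bilform)%type.

Definition cocycle (f : cochain2) : Prop :=
  [/\ forall i j k : Q, f.1 i (j ⊣ k) = f.1 i (j ⊢ k),
      forall i j k : Q, f.1 (i ⊢ j) k = f.2 i (j ⊣ k),
      forall i j k : Q, f.2 (i ⊣ j) k = f.2 (i ⊢ j) k,
      forall i j k : Q, f.1 i (j ⊣ k) = f.1 (i ⊣ j) k
    & forall i j k : Q, f.2 i (j ⊢ k) = f.2 (i ⊢ j) k].

Definition coboundary (f : cochain2) : Prop :=
  exists eps : 'Hom(Q, F^o), forall x y : Q,
    f.1 x y = - eps (x ⊣ y) /\ f.2 x y = - eps (x ⊢ y).

(* Both conditions are linear, so the spans contain nothing new: see [Z2P] and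
   [B2P] below. *)
Definition Z2 : {vspace cochain2} := vspan cocycle.
Definition B2 : {vspace cochain2} := vspan coboundary.

Let bilformP a (f g : bilform) x y : (a *: f + g) x y = a * f x y + g x y.
Proof. by rewrite !(add_lfunE, scale_lfunE). Qed.

Let bilform0 x y : (0 : bilform) x y = 0.
Proof. by rewrite !zero_lfunE. Qed.

Lemma Z2P f : f \in Z2 <-> cocycle f.
Proof.
apply: vspanP => [|a x y [x1 x2 x3 x4 x5] [y1 y2 y3 y4 y5]].
  by split=> i j k; rewrite /= !bilform0.
split=> i j k; rewrite /= !bilformP.
- by rewrite x1 y1.
- by rewrite x2 y2.
- by rewrite x3 y3.
- by rewrite x4 y4.
- by rewrite x5 y5.
Qed.

Lemma B2P f : f \in B2 <-> coboundary f.
Proof.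
apply: vspanP => [|a f1 f2 [e1 He1] [e2 He2]].
  by exists 0 => x y; rewrite /= !bilform0 !zero_lfunE oppr0.
exists (a *: e1 + e2) => x y; rewrite /= !bilformP.
have [-> ->] := He1 x y; have [-> ->] := He2 x y.
by rewrite !add_lfunE !scale_lfunE !opprD !mulrN.
Qed.

Lemma subB2Z2 : (B2 <= Z2)%VS.
Proof.
apply/subvP => f /B2P[e He]; apply/Z2P.
have [He1 He2] : (forall x y, f.1 x y = - e (x ⊣ y)) /\
                 (forall x y, f.2 x y = - e (x ⊢ y)).
  by split=> x y; have [] := He x y.
split=> i j k; rewrite !(He1, He2).
- by rewrite dil_lr.
- by rewrite dirl_dil.
- by rewrite dir_lr.
- by rewrite dilA.
- by rewrite dirA.
Qed.

(* [B2] viewed inside the vector space [Z2]. *)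
Definition B2inZ2 : {vspace subvs_of Z2} :=
  (linfun (vsval : subvs_of Z2 -> cochain2) @^-1: B2)%VS.

Definition H2 := quotv B2inZ2.
HB.instance Definition _ := Vector.on H2.

Lemma dim_H2 : \dim {:H2} = (\dim Z2 - \dim B2)%N.
Proof.
rewrite dim_quotv; congr (_ - _)%N; first by rewrite dimvf.
rewrite -(limg_dim_eq (f := linfun (vsval : subvs_of Z2 -> cochain2))) /=.
  rewrite lpreimK //; apply/subvP => f fB; apply/memv_imgP.
  exists (vsproj Z2 f); first exact: memvf.
  by rewrite lfunE /= vsprojK // (subvP subB2Z2).
suff -> : lker (linfun (vsval : subvs_of Z2 -> cochain2)) = 0%VS by rewrite capv0.
by apply/eqP/lker0P => x y; rewrite !lfunE /= => /val_inj.
Qed.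

End Cohomology.

(* Main.v *)
From HB Require Import structures.
Require Import Defs.
From mathcomp Require Import all_boot all_order all_algebra.
From mathcomp Require Import zify.

Local Open Scope ring_scope.

Import GRing.Theory.

(** Write [n = dim L], [m = dim L'] and [d = n - m = dim (L / L')].

    A vector space complement [U] of [L'] generates the nilpotent algebra [L],
    and more precisely every right ideal of [L] containing [U] is all of [L]
    ([nilpotent_ideal_full]).  For a cocycle [f] the vectors [x] such that
    [f.1 x] and [f.2 x] both vanish form a right ideal, because each of
    [f.1 (x ⊣ y) z], [f.1 (x ⊢ y) z], [f.2 (x ⊣ y) z], [f.2 (x ⊢ y) z] is a
    value of a form of the pair at [x].  Hence [f] is determined by its
    restriction to [U] in the first variable, and [dim Z2(L) <= 2 d n]
    ([dim_Z2_le]).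

    A functional on [L'] is determined by its values on products, so the
    coboundaries form a space of dimension at least [m] ([dim_B2_ge]).  Finally
    the products of [L / L'] vanish, so that every pair of bilinear forms on it
    is a cocycle and only [0] is a coboundary: [dim H2(L / L') = 2 d ^ 2]
    ([dim_H2_abelian]).  Altogether

      [dim H2(L) <= 2 d n - m = 2 d ^ 2 + m (2 d - 1)],

    which is at most the claimed [2 d ^ 2 + m (4 d - 1)]. *)

Section BilinearForms.
Variables (F : fieldType) (vT : vectType F).

(** The curried linear map attached to a function of two variables; it only has
    a meaning when the function is bilinear. *)
Definition bilform_of (b : vT -> vT -> F^o) : 'Hom(vT, 'Hom(vT, F^o)) :=
  linfun (fun x => linfun (b x)).

Lemma bilform_ofE (b : vT -> vT -> F^o) :
    (forall x, linear (b x)) -> (forall y, linear (b^~ y)) ->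
  forall x y, bilform_of b x y = b x y.
Proof.
move=> br bl x y.
pose bR z : {linear vT -> F^o} :=
  HB.pack (b z) (GRing.isLinear.Build _ _ _ _ (b z) (br z)).
have bE z t : linfun (b z) t = b z t by exact: (lfunE (bR z)).
have b_lin : linear (fun z => linfun (b z)).
  move=> a z t; apply/lfunP => w.
  by rewrite add_lfunE scale_lfunE !bE bl.
pose bL : {linear vT -> 'Hom(vT, F^o)} :=
  HB.pack (fun z => linfun (b z)) (GRing.isLinear.Build _ _ _ _ _ b_lin).
by rewrite /bilform_of (lfunE bL) /= bE.
Qed.

End BilinearForms.

Lemma dim_bilform_pair (F : fieldType) (uT vT : vectType F) :
  \dim {: ('Hom(uT, 'Hom(vT, F^o)) * 'Hom(uT, 'Hom(vT, F^o)))%type}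
    = (2 * (\dim {:uT} * \dim {:vT}))%N.
Proof.
rewrite !dimvf.
have -> : dim ('Hom(uT, 'Hom(vT, F^o)) * 'Hom(uT, 'Hom(vT, F^o)))%type
        = (dim uT * (dim vT * 1) + dim uT * (dim vT * 1))%N by [].
by rewrite muln1 mul2n addnn.
Qed.

Section Nilpotent.
Variables (F : fieldType) (L : diassocType F).
Implicit Types (K : {vspace L}).

Lemma dil_lcs k (x y : L) : (0 < k)%N -> x \in lcs L k -> x ⊣ y \in lcs L k.+1.
Proof.
move=> k0 xk; rewrite lcsS // big_nat_recr //= subSnn lcs1.
apply: subvP (addvSr _ _) _ _; apply: subvP (addvSl _ _) _ _.
by apply: mem_vspan; exists x, y; rewrite memvf.
Qed.

Lemma dir_lcs k (x y : L) : (0 < k)%N -> x \in lcs L k -> x ⊢ y \in lcs L k.+1.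
Proof.
move=> k0 xk; rewrite lcsS // big_nat_recr //= subSnn lcs1.
apply: subvP (addvSr _ _) _ _; apply: subvP (addvSr _ _) _ _.
by apply: mem_vspan; exists x, y; rewrite memvf.
Qed.

Lemma derived_sub (V : {vspace L}) :
  (forall x y, x ⊣ y \in V) -> (forall x y, x ⊢ y \in V) -> (derived L <= V)%VS.
Proof.
move=> Vl Vr; rewrite subv_add; apply/andP.
by split; apply: vspan_sub => _ [x [y [_ _ ->]]].
Qed.

(** If [L = K + L^k] then [L' = L ◊ L] lies in [K + L^(k+1)], as [K] is a right
    ideal; so [L = K + L^k] for all [k]. *)
Lemma nilpotent_ideal_full K :
    nilpotent L ->
    (forall x y, x \in K -> x ⊣ y \in K) ->
    (forall x y, x \in K -> x ⊢ y \in K) ->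
    (K + derived L)%VS = fullv ->
  K = fullv.
Proof.
move=> [n Ln0] Kl Kr Kgen.
have full k : (K + lcs L k.+1)%VS = fullv.
  elim: k => [|k IHk]; first by rewrite lcs1 addvf.
  apply/eqP; rewrite eqEsubv subvf /= -Kgen subv_add addvSl /=.
  apply: derived_sub => x y; have := memvf x; rewrite -IHk.
    case/memv_addP=> u uK [v vk ->]; rewrite linearDl /=.
    by apply: memv_add; [apply: Kl | apply: dil_lcs].
  case/memv_addP=> u uK [v vk ->]; rewrite linearDl /=.
  by apply: memv_add; [apply: Kr | apply: dir_lcs].
by rewrite -(full n) Ln0 addv0.
Qed.

End Nilpotent.

Section Cocycles.
Variables (F : fieldType) (L : diassocType F).
Local Notation bilform := 'Hom(L, 'Hom(L, F^o)).
Local Notation cochain2 := (bilform * bilform)%type.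

Lemma cocycle_eq0 (U : {vspace L}) (f : cochain2) :
    nilpotent L -> (U + derived L)%VS = fullv -> cocycle f ->
    (U <= lker f.1)%VS -> (U <= lker f.2)%VS ->
  f = 0.
Proof.
move=> nilL Ugen [c1 c2 c3 c4 c5] U1 U2.
pose K := (lker f.1 :&: lker f.2)%VS.
have KP x : reflect (f.1 x = 0 /\ f.2 x = 0) (x \in K).
  rewrite memv_cap !memv_ker.
  by apply: (iffP andP) => -[/eqP-> /eqP->].
have Kfull : K = fullv.
  apply: nilpotent_ideal_full => //.
  - move=> x y /KP[x1 x2]; apply/KP; split; apply/lfunP => z.
      by rewrite -c4 x1 !zero_lfunE.
    by rewrite c3 -c5 x2 !zero_lfunE.
  - move=> x y /KP[x1 x2]; apply/KP; split; apply/lfunP => z.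
      by rewrite c2 x2 !zero_lfunE.
    by rewrite -c5 x2 !zero_lfunE.
  apply/eqP; rewrite eqEsubv subvf -Ugen addvS ?subv_cap ?U1 //.
have f0 x : f.1 x = 0 /\ f.2 x = 0 by apply/KP; rewrite Kfull memvf.
by rewrite [f]surjective_pairing; congr pair; apply/lfunP => x;
  rewrite zero_lfunE; case: (f0 x).
Qed.

(** Restriction of both forms to a subspace in the first variable. *)
Definition restr_cochain (U : {vspace L}) (f : cochain2) :
    'Hom(subvs_of U, 'Hom(L, F^o)) * 'Hom(subvs_of U, 'Hom(L, F^o)) :=
  (f.1 \o linfun vsval, f.2 \o linfun vsval)%VF.

Fact restr_cochain_is_linear U : linear (restr_cochain U).
Proof.
move=> a f g; rewrite /restr_cochain /=.
by rewrite !comp_lfunDl -!comp_lfunZl.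
Qed.
HB.instance Definition _ U :=
  GRing.isLinear.Build F _ _ _ (restr_cochain U) (restr_cochain_is_linear U).

Lemma dim_Z2_le : nilpotent L ->
  (\dim (Z2 L) <= 2 * (\dim {: dquot L} * \dim {:L}))%N.
Proof.
move=> nilL; set U := (derived L)^C%VS.
have Ugen : (U + derived L)%VS = fullv by rewrite addvC addv_complf.
have dimU : \dim U = \dim {: dquot L} by rewrite dimv_compl dim_quotv.
rewrite -(@limg_dim_eq _ _ _ (linfun (restr_cochain U))); last first.
  apply/eqP; rewrite -subv0; apply/subvP => f.
  rewrite memv_cap memv_ker lfunE /= => /andP[/Z2P fZ /eqP[f1 f2]].
  rewrite memv0; apply/eqP; apply: (@cocycle_eq0 U) => //.
    apply/subvP => u uU; rewrite memv_ker; apply/eqP.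
    have := congr1 (fun g : 'Hom(_, _) => g (vsproj U u)) f1.
    by rewrite comp_lfunE zero_lfunE lfunE /= vsprojK.
  apply/subvP => u uU; rewrite memv_ker; apply/eqP.
  have := congr1 (fun g : 'Hom(_, _) => g (vsproj U u)) f2.
  by rewrite comp_lfunE zero_lfunE lfunE /= vsprojK.
apply: leq_trans (dimvS (subvf _)) _; rewrite dim_bilform_pair -dimU.
by rewrite (dimvf (subvs_of U)).
Qed.

(** The coboundary of a functional on [L'].  As all products lie in [L'], the
    projection [vsproj] onto [L'] only serves to give them the type of elements
    of [L']. *)
Definition cobound (e : 'Hom(subvs_of (derived L), F^o)) : cochain2 :=
  (bilform_of F L (fun x y => - e (vsproj (derived L) (x ⊣ y))),
   bilform_of F L (fun x y => - e (vsproj (derived L) (x ⊢ y)))).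

Lemma coboundE e x y :
  (cobound e).1 x y = - e (vsproj (derived L) (x ⊣ y)) /\
  (cobound e).2 x y = - e (vsproj (derived L) (x ⊢ y)).
Proof.
split; apply: bilform_ofE => {x y} z a x y;
  by rewrite ?linearPl ?linearPr linearP /= linearP /= opprD scalerN.
Qed.

Fact cobound_is_linear : linear cobound.
Proof.
move=> a e1 e2; apply/eqP; rewrite xpair_eqE; apply/andP.
by split; apply/eqP/lfunP => x; apply/lfunP => y;
  rewrite !add_lfunE !scale_lfunE ?(coboundE _ x y).1 ?(coboundE _ x y).2
    add_lfunE scale_lfunE opprD scalerN.
Qed.
HB.instance Definition _ :=
  GRing.isLinear.Build F _ _ _ cobound cobound_is_linear.

Lemma dim_B2_ge : (\dim (derived L) <= \dim (B2 L))%N.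
Proof.
have cob_inj : (fullv :&: lker (linfun cobound))%VS = 0%VS.
  rewrite capfv; apply/eqP; rewrite -subv0; apply/subvP => e.
  rewrite memv_ker lfunE /= memv0 => /eqP e0.
  have e0l x y : e (vsproj (derived L) (x ⊣ y)) = 0.
    by apply: oppr_inj; rewrite -(coboundE e x y).1 e0 /= !zero_lfunE oppr0.
  have e0r x y : e (vsproj (derived L) (x ⊢ y)) = 0.
    by apply: oppr_inj; rewrite -(coboundE e x y).2 e0 /= !zero_lfunE oppr0.
  have : (derived L <= lker (e \o linfun (vsproj (derived L))))%VS.
    by apply: derived_sub => x y; rewrite memv_ker comp_lfunE lfunE /= ?e0l ?e0r.
  move/subvP => ker_e; apply/eqP/lfunP => v.
  have := ker_e _ (subvsP v).
  by rewrite memv_ker comp_lfunE lfunE /= vsvalK zero_lfunE => /eqP.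
have dimE : \dim (linfun cobound @: fullv) = \dim (derived L).
  rewrite limg_dim_eq // dimvf.
  have -> : dim 'Hom(subvs_of (derived L), F^o) = (\dim (derived L) * 1)%N by [].
  exact: muln1.
rewrite -dimE; apply/dimvS/subvP => _ /memv_imgP[e _ ->].
apply/B2P; exists (e \o linfun (vsproj (derived L)))%VF => x y.
by rewrite !comp_lfunE !lfunE /=; apply: coboundE.
Qed.

End Cocycles.

Lemma dim_H2_abelian (F : fieldType) (A : diassocType F) :
    (forall x y : A, x ⊣ y = 0) -> (forall x y : A, x ⊢ y = 0) ->
  \dim {: H2 A} = (2 * \dim {:A} ^ 2)%N.
Proof.
move=> dil0 dir0; rewrite dim_H2.
have -> : Z2 A = fullv.
  apply/eqP; rewrite eqEsubv subvf; apply/subvP => f _; apply/Z2P.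
  by split=> i j k; rewrite ?dil0 ?dir0 ?linear0 ?zero_lfunE.
have -> : B2 A = 0%VS.
  apply/eqP; rewrite -subv0; apply/subvP => f /B2P[e fE].
  rewrite memv0 [f]surjective_pairing xpair_eqE; apply/andP.
  split; apply/eqP/lfunP => x; apply/lfunP => y; have [f1 f2] := fE x y.
    by rewrite f1 dil0 linear0 oppr0 !zero_lfunE.
  by rewrite f2 dir0 linear0 oppr0 !zero_lfunE.
by rewrite dimv0 subn0 dim_bilform_pair.
Qed.

Lemma dil_dquot (F : fieldType) (L : diassocType F) (x y : dquot L) : x ⊣ y = 0.
Proof.
apply/eqP; rewrite -(linear0 (piv (derived L))) piv_eq subr0.
exact: dil_derived.
Qed.

Lemma dir_dquot (F : fieldType) (L : diassocType F) (x y : dquot L) : x ⊢ y = 0.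
Proof.
apply/eqP; rewrite -(linear0 (piv (derived L))) piv_eq subr0.
exact: dir_derived.
Qed.

Theorem corollary4p6 (F : fieldType) (L : diassocType F) (hL : nilpotent L) :
  (\dim {: H2 L})%:Z <=
    (\dim {: H2 (dquot L)})%:Z
    + (\dim (derived L))%:Z * (4 * (\dim {: dquot L})%:Z - 1).
Proof.
have Z2_le := dim_Z2_le F L hL.
have B2_ge := dim_B2_ge F L.
have B2_le := dimvS (subB2Z2 L).
have dimL : \dim {:L} = (\dim {: dquot L} + \dim (derived L))%N.
  by rewrite dim_quotv subnK ?dimvS ?subvf.
rewrite dim_H2 (dim_H2_abelian F _ (dil_dquot F L) (dir_dquot F L)).
rewrite dimL mulnDr in Z2_le.
move: (\dim (Z2 L)) (\dim (B2 L)) (\dim (derived L)) (\dim {: dquot L})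
  Z2_le B2_ge B2_le => z b m d.
rewrite -mulnn mulrBr mulr1 mulrCA -!PoszM.
rewrite (mulnC m d); lia.
Qed.
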